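(* Let $\Pi=(\Pi_n)_{n\in\mathbb{N}}$ be a $d$-bounded graph property that can be tested with query complexity $q(\varepsilon,d)$. Then there exist a constant $c>1$ and, for every $\varepsilon>0$ and $d$, a number $n_1=n_1(\varepsilon,d)$ such that, with $t:=c\cdot q(\varepsilon,d)$, for every $n\ge n_1$ there exists a randomized algorithm $\mathcal{T}_C$ with adjacency-list query access to $d$-bounded $n$-vertex graphs that makes at most $t\cdot d^{t+2}$ queries and (1) accepts any $d$-bounded $n$-vertex graph $G$ with probability at least $2/3$ if $\min_{G'\in\Pi_n}\|\mathrm{freq}_t(G)-\mathrm{freq}_t(G')\|_1\le\frac{1}{12t}$; (2) rejects any $d$-bounded $n$-vertex graph $G$ with probability at least $2/3$ if $\min_{G'\in\Pi_n^{\varepsilon\text{-far}}}\|\mathrm{freq}_t(G)-\mathrm{freq}_t(G')\|_1\le\frac{1}{12t}$.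
   Context: A graph is $d$-bounded if its maximum degree is at most $d$. A graph property is a set of graphs closed under isomorphism; $\Pi_n$ is its set of $n$-vertex members. An $n$-vertex $d$-bounded graph is $\varepsilon$-far from $\Pi_n$ if more than $\varepsilon dn$ edge modifications are needed to obtain a graph in $\Pi_n$; $\Pi_n^{\varepsilon\text{-far}}$ denotes the set of all $n$-vertex $d$-bounded graphs $\varepsilon$-far from $\Pi_n$. Query access: a query $(u,i)$, $i\le d$, returns the $i$-th neighbor of $u$ or a special symbol if none. $\Pi$ is testable with query complexity $q(\varepsilon,d)$ if there is a randomized algorithm that, given $\varepsilon,n,d$ and such query access to an $n$-vertex $d$-bounded graph, makes at most $q(\varepsilon,d)$ queries and with probability at least $2/3$ accepts graphs in $\Pi_n$ and rejects graphs in $\Pi_n^{\varepsilon\text{-far}}$. The $t$-disc of a vertex $v$ is the subgraph induced by vertices at distance at most $t$ from $v$, rooted at $v$; $\mathrm{freq}_t(G)$ is the vector indexed by root-preserving isomorphism types of $t$-discs of $d$-bounded graphs, giving the fraction of vertices of $G$ whose $t$-disc has each type; $\|\cdot\|_1$ is the $\ell_1$-norm. *)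

(* Defs.v *)
From HB Require Import structures.
From mathcomp Require Import all_boot all_order all_algebra.
From mathcomp Require Import generic_quotient.
From mathcomp Require Import boolp classical_sets fsbigop reals constructive_ereal.

Set Implicit Arguments.
Unset Strict Implicit.
Unset Printing Implicit Defensive.

Import Order.TTheory GRing.Theory Num.Theory.
Local Open Scope quotient_scope.
Local Open Scope ring_scope.

(** * Finite simple graphs *)

Definition simple_rel n (A : {set 'I_n * 'I_n}) : bool :=
  [forall u, (u, u) \notin A] &&
  [forall u, forall v, ((u, v) \in A) == ((v, u) \in A)].

Record sgraph (n : nat) := SGraph {
  arcs : {set 'I_n * 'I_n};
  arcs_simple : simple_rel arcs
}.

HB.instance Definition _ n := [isSub for @arcs n].
HB.instance Definition _ n := [Finite of sgraph n by <:].

Definition adj n (G : sgraph n) : rel 'I_n := fun u v => (u, v) \in arcs G.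

Lemma adj_irr n (G : sgraph n) u : adj G u u = false.
Proof. by have /andP[/forallP/(_ u)/negbTE] := arcs_simple G. Qed.

Lemma adj_sym n (G : sgraph n) : symmetric (adj G).
Proof.
by move=> u v; have /andP[_ /forallP/(_ u)/forallP/(_ v)/eqP] := arcs_simple G.
Qed.

Definition bounded (d n : nat) (G : sgraph n) : Prop :=
  forall u, (#|[set v | adj G u v]| <= d)%N.

Definition isomorphism m n (G : sgraph m) (H : sgraph n) (f : 'I_m -> 'I_n) :
    Prop :=
  bijective f /\ forall u v, adj H (f u) (f v) = adj G u v.

(* Number of edge insertions and deletions turning [G] into [H]; each unordered
   pair of vertices is counted once, as the ordered pair [u < v]. *)
Definition edit_dist n (G H : sgraph n) : nat :=
  #|[set e : 'I_n * 'I_n | (e.1 < e.2)%N & adj G e.1 e.2 != adj H e.1 e.2]|.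

(** * Graph properties *)

(* [P n] is the set of the [n]-vertex members, on the vertex set ['I_n]. *)
Definition graph_family := forall n, set (sgraph n).

Definition iso_closed (P : graph_family) : Prop :=
  forall n (G H : sgraph n),
    (exists f, isomorphism G H f) -> P n G -> P n H.

Definition bounded_property (d : nat) (P : graph_family) : Prop :=
  iso_closed P /\ forall n G, P n G -> bounded d G.

(* If [P n] is empty, every [d]-bounded [n]-vertex graph is far from it. *)
Definition far (R : realType) (d : nat) (eps : R) (P : graph_family) :
    graph_family :=
  fun n => [set G | bounded d G /\
    forall H, P n H -> eps * d%:R * n%:R < (edit_dist G H)%:R]%classic.
Arguments far {R} d eps P n _.

(** * Query algorithms *)

(* Answers to the queries [(u, i)]; the slots are numbered from 0, and [None] is
   the special symbol. *)
Definition oracle (n d : nat) := 'I_n -> 'I_d -> option 'I_n.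

(* The neighbors of each vertex may be listed in any order. *)
Definition represents n d (O : oracle n d) (G : sgraph n) : Prop :=
  forall u, exists s : seq 'I_n,
    [/\ uniq s, s =i adj G u & forall i : 'I_d, O u i = onth s i].

Inductive dtree (n d : nat) : Type :=
| Output of bool
| Query of 'I_n & 'I_d & (option 'I_n -> dtree n d).

Fixpoint run n d (T : dtree n d) (O : oracle n d) : bool :=
  match T with
  | Output b => b
  | Query u i k => run (k (O u i)) O
  end.

Fixpoint num_queries n d (T : dtree n d) (O : oracle n d) : nat :=
  match T with
  | Output _ => 0%N
  | Query u i k => (num_queries (k (O u i)) O).+1
  end.

(* A randomized algorithm is a probability distribution on deterministic
   adaptive ones. Finitely many seeds suffice: for fixed [n], [d] and a bounded
   number of queries there are only finitely many deterministic strategies. *)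
Record ralg (R : realType) (n d : nat) := RAlg {
  seed : finType;
  weight : seed -> R;
  weight_ge0 : forall w, 0 <= weight w;
  weight_sum1 : \sum_w weight w = 1;
  strategy : seed -> dtree n d
}.
Arguments weight {R n d} r w.
Arguments strategy {R n d} r w.

Definition prob_accept (R : realType) n d (A : ralg R n d) (O : oracle n d) : R :=
  \sum_(w | run (strategy A w) O) weight A w.

Definition prob_reject (R : realType) n d (A : ralg R n d) (O : oracle n d) : R :=
  \sum_(w | ~~ run (strategy A w) O) weight A w.

Definition makes_at_most (R : realType) n d (A : ralg R n d) (m : nat) : Prop :=
  forall (G : sgraph n) (O : oracle n d), bounded d G -> represents O G ->
  forall w : seed A, (num_queries (strategy A w) O <= m)%N.

Definition accepts (R : realType) n d (A : ralg R n d) (G : sgraph n) : Prop :=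
  forall O : oracle n d, represents O G -> 2 / 3 <= prob_accept A O.

Definition rejects (R : realType) n d (A : ralg R n d) (G : sgraph n) : Prop :=
  forall O : oracle n d, represents O G -> 2 / 3 <= prob_reject A O.

(* The degree bound [d] is an input of the tester, and [Pi d] is the property of
   [d]-bounded graphs being tested. *)
Definition testable (R : realType) (Pi : nat -> graph_family)
    (q : R -> nat -> nat) : Prop :=
  exists A : forall (eps : R) (n d : nat), ralg R n d,
  forall (eps : R) (n d : nat), 0 < eps ->
    [/\ makes_at_most (A eps n d) (q eps d),
        forall G, Pi d n G -> accepts (A eps n d) G
      & forall G, far d eps (Pi d) n G -> rejects (A eps n d) G].

(** * Discs and frequency vectors *)

Definition ball n (G : sgraph n) (t : nat) (v : 'I_n) : {set 'I_n} :=
  [set w | [exists k : 'I_t.+1, exists p : k.-tuple 'I_n,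
     path (adj G) v p && (last v p == w)]].

Lemma ball_root n (G : sgraph n) t v : v \in ball G t v.
Proof.
rewrite inE; apply/existsP; exists ord0; apply/existsP; exists [tuple].
by rewrite /= eqxx.
Qed.

Lemma induced_simple n (G : sgraph n) (S : {set 'I_n}) :
  simple_rel [set e : 'I_#|S| * 'I_#|S| | adj G (enum_val e.1) (enum_val e.2)].
Proof.
apply/andP; split; first by apply/forallP => i; rewrite inE /= adj_irr.
by apply/forallP => i; apply/forallP => j; rewrite !inE /= adj_sym.
Qed.

Definition induced n (G : sgraph n) (S : {set 'I_n}) : sgraph #|S| :=
  SGraph (induced_simple G S).

(* [existT _ k (G, r)] is the [k]-vertex graph [G] rooted at [r]. *)
Definition rgraph : Type := {k : nat & (sgraph k * 'I_k)%type}.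
HB.instance Definition _ := Choice.on rgraph.

Definition disc n (G : sgraph n) (t : nat) (v : 'I_n) : rgraph :=
  existT _ #|ball G t v|
    (induced G (ball G t v), enum_rank_in (ball_root G t v) v).

Definition riso (D E : rgraph) : bool :=
  `[< exists f, isomorphism (tagged D).1 (tagged E).1 f /\
        f (tagged D).2 = (tagged E).2 >].

Lemma riso_refl : reflexive riso.
Proof. by move=> D; apply/asboolP; exists id; split=> //; split=> //; exists id. Qed.

Lemma riso_sym : symmetric riso.
Proof.
suff H D E : riso D E -> riso E D by move=> D E; apply/idP/idP; exact: H.
move=> /asboolP[f [[[g fK gK] fadj] froot]]; apply/asboolP; exists g.
split; last by rewrite -froot fK.
by split=> [|u v]; [exists f | rewrite -fadj !gK].
Qed.

Lemma riso_trans : transitive riso.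
Proof.
move=> E D F /asboolP[f [[bf fadj] froot]] /asboolP[g [[bg gadj] groot]].
apply/asboolP; exists (g \o f); split; last by rewrite /= froot.
by split=> [|u v]; [exact: bij_comp | rewrite /= gadj fadj].
Qed.

Canonical riso_equiv := EquivRel riso riso_refl riso_sym riso_trans.

(* Root-preserving isomorphism types. *)
Definition rtype := {eq_quot riso}.
HB.instance Definition _ := Choice.on rtype.

Definition disc_type n (G : sgraph n) (t : nat) (v : 'I_n) : rtype :=
  \pi_{eq_quot riso} (disc G t v).

Definition disc_types (d t : nat) : set rtype :=
  [set x | exists n (G : sgraph n) v, bounded d G /\ disc_type G t v = x]%classic.

Definition freq (R : realType) (t n : nat) (G : sgraph n) (x : rtype) : R :=
  #|[set v | disc_type G t v == x]|%:R / n%:R.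

(* A sum over all of [disc_types d t]; only finitely many terms are nonzero. *)
Definition freq_dist (R : realType) (d t n : nat) (G H : sgraph n) : R :=
  \sum_(x \in disc_types d t) `|freq R t G x - freq R t H x|.

(* The minimum over the finite set [P]; it is [+oo] if [P] is empty. *)
Definition min_freq_dist (R : realType) (d t n : nat) (G : sgraph n)
    (P : set (sgraph n)) : \bar R :=
  \big[Order.min/+oo%E]_(H : sgraph n | `[< P H >]) (freq_dist R d t G H)%:E.

(* Main.v *)
(* The canonical tester gives the vertices of the input graph random names, sorts
   the adjacency lists by name, and takes the majority of three runs of the given
   tester; each query is answered by listing all neighbors of one vertex. Its
   acceptance probability is at least 20/27 on the property and at most 7/27 on
   graphs far from it, so it suffices that this probability differs by at most
   1/16 between two graphs with close frequency vectors. Fix the coins. The names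
   are exposed lazily: a query to a name not seen before hits a uniformly random
   unseen vertex. Match the vertices of both graphs so that almost all matched
   pairs have isomorphic discs. If the fresh vertex is matched to one with the same
   disc, and both lie far from what is already exposed, the second graph can be
   relabelled so that both graphs agree around all exposed vertices, and the two
   runs continue identically until the next fresh vertex. The exceptional vertices
   are the O(1) ones near the exposed region and the few badly matched ones. *)

Require Import Defs.
From mathcomp Require Import all_boot all_order all_algebra all_fingroup.
From mathcomp Require Import generic_quotient.
From mathcomp Require Import boolp reals constructive_ereal.
From mathcomp Require classical_sets fsbigop.
From mathcomp Require Import zify ring lra.

Set Implicit Arguments.
Unset Strict Implicit.
Unset Printing Implicit Defensive.

Import Order.TTheory GRing.Theory Num.Theory.
Local Open Scope ring_scope.

(** * Permutations: extending partial injections and matching equal values *)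

Lemma perm_extend (T : finType) (D : {set T}) (h : T -> T) :
  {in D &, injective h} -> exists tau : {perm T}, {in D, tau =1 h}.
Proof.
move=> inj_h.
suff H (s : seq T) : {subset s <= D} -> exists tau : {perm T}, {in s, tau =1 h}.
  have [x|tau taus] := H (enum D); first by rewrite mem_enum.
  by exists tau => x xD; apply: taus; rewrite mem_enum.
elim: s => [|x s IHs] sD; first by exists 1%g.
have [|tau taus] := IHs; first by move=> y ys; apply: sD; rewrite inE ys orbT.
have xD : x \in D by apply: sD; rewrite mem_head.
(* The transposition corrects the value at [x] only: for other [y] in [s], [tau y = h y] differs
   from [tau x] and, by injectivity of [h], from [h x]. *)
exists (tau * tperm (tau x) (h x))%g => y; rewrite inE permM.
have [-> _|neq_yx /= ys] := eqVneq y x; first by rewrite tpermL.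
rewrite tpermD ?(inj_eq perm_inj) 1?eq_sym ?taus //.
apply: contra_neq neq_yx => /inj_h -> //; apply: sD.
by rewrite inE ys orbT.
Qed.

(* A permutation maximising the number of matches leaves, for each value, at most
   one of the two functions with unmatched points: otherwise swap two of them. *)
Lemma matching_perm (T : finType) (K : eqType) (f g : T -> K) (U : seq K) :
  uniq U -> (forall x, f x \in U) ->
  exists phi : {perm T},
    (#|[set x | f x != g (phi x)]| <=
       \sum_(k <- U) (#|[set x | f x == k]| - #|[set x | g x == k]|))%N.
Proof.
move=> uniqU fU.
pose M (phi : {perm T}) := #|[set x | f x == g (phi x)]|.
have [phi _ phi_max] := @arg_maxnP _ 1%g xpredT M isT.
exists phi.
have -> : #|[set x | f x != g (phi x)]| =
    (\sum_(k <- U) #|[set x | (f x == k) && (f x != g (phi x))]|)%N.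
  have E k : #|[set x | (f x == k) && (f x != g (phi x))]| =
      (\sum_(x | f x != g (phi x)) (f x == k))%N.
    rewrite -sum1dep_card [RHS]big_mkcond [LHS]big_mkcond /=.
    by apply: eq_bigr => x _; do 2 case: (_ == _).
  rewrite (eq_bigr _ (fun k _ => E k)) exchange_big /= -sum1dep_card.
  apply: eq_bigr => x _.
  rewrite (bigD1_seq (f x)) //= eqxx big1 // => k neq_k.
  by rewrite eq_sym (negbTE neq_k).
apply: leq_sum => k _.
have [->|] := posnP #|[set x | (f x == k) && (f x != g (phi x))]|; first by [].
rewrite card_gt0 => /set0Pn[x]; rewrite inE => /andP[/eqP fx mx].
have cardg : #|[set y | g y == k]| = #|[set y | g (phi y) == k]|.
  rewrite -(card_imset [set y | g (phi y) == k] (@perm_inj _ phi)).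
  apply: eq_card => y; rewrite inE -[y in LHS](permKV phi).
  rewrite -[y in RHS](permKV phi) mem_imset ?inE //; exact: perm_inj.
have subk : [set y | g (phi y) == k] \subset [set y | f y == k].
  apply/subsetP => y; rewrite !inE => /eqP gy; apply/negPn/negP => fy.
  have neq_xy : x != y.
    by apply: contra_neq fy => <-.
  pose psi := (tperm x y * phi)%g.
  have : (M phi < M psi)%N.
    apply: proper_card; apply/properP; split.
      apply/subsetP => z; rewrite !inE permM.
      have [->|zx] := eqVneq z x; first by rewrite (negbTE mx).
      have [->|zy] := eqVneq z y; first by rewrite gy (negbTE fy).
      by rewrite tpermD // eq_sym.
    by exists x; rewrite !inE ?permM ?tpermL ?fx ?gy // -fx (negbTE mx).
  by rewrite ltnNge [(_ <= _)%N]phi_max.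
rewrite cardg -cardsDS //; apply: subset_leq_card.
apply/subsetP => y; rewrite !inE => /andP[/eqP-> ].
by rewrite eqxx andbT eq_sym.
Qed.

(** * Relabelling a graph by a permutation *)

Section Pull.
Variable n : nat.
Implicit Types (G H : sgraph n) (h p : {perm 'I_n}).

Lemma pull_simple h G :
  simple_rel [set e : 'I_n * 'I_n | adj G (h e.1) (h e.2)].
Proof.
apply/andP; split; first by apply/forallP => u; rewrite inE /= adj_irr.
by apply/forallP => u; apply/forallP => v; rewrite !inE /= adj_sym.
Qed.

(* The graph obtained from [G] by giving the vertex [h u] the name [u]. *)
Definition pull h G : sgraph n := SGraph (pull_simple h G).

Lemma adj_pull h G u v : adj (pull h G) u v = adj G (h u) (h v).
Proof. by rewrite /adj inE. Qed.

Lemma sgraph_ext G H : (forall u v, adj G u v = adj H u v) -> G = H.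
Proof. by move=> GH; apply: val_inj; apply/setP => -[u v]; exact: GH. Qed.

Lemma pullM p h G : pull (p * h) G = pull p (pull h G).
Proof. by apply: sgraph_ext => u v; rewrite !adj_pull !permM. Qed.

Lemma pull1 G : pull 1 G = G.
Proof. by apply: sgraph_ext => u v; rewrite adj_pull !perm1. Qed.

Lemma pullK h G : pull h^-1 (pull h G) = G.
Proof. by rewrite -pullM mulVg pull1. Qed.

Lemma pull_isomorphism h G : isomorphism (pull h G) G h.
Proof.
by split; [exists (h^-1)%g => u; rewrite ?permK ?permKV | move=> u v; rewrite adj_pull].
Qed.

Lemma pull_bounded d h G : bounded d G -> bounded d (pull h G).
Proof.
move=> bG u; apply: leq_trans (bG (h u)).
rewrite -(card_imset _ (@perm_inj _ h)); apply: subset_leq_card.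
by apply/subsetP => _ /imsetP[v + ->]; rewrite !inE adj_pull.
Qed.

(** Relabelling does not respect the order by which [edit_dist] counts each pair once; the set of
    all differing ordered pairs is carried along bijectively. *)
Lemma double_edit_dist G H :
  (edit_dist G H).*2 = #|[set e : 'I_n * 'I_n | adj G e.1 e.2 != adj H e.1 e.2]|.
Proof.
set E := [set e | _].
pose lt := [set e : 'I_n * 'I_n | (e.1 < e.2)%N].
rewrite -(cardsID lt E) -addnn; congr (_ + _)%N.
  by apply: eq_card => e; rewrite !inE andbC.
pose sw (e : 'I_n * 'I_n) := (e.2, e.1).
have swK : cancel sw sw by case.
rewrite /edit_dist -(card_imset _ (can_inj swK)).
apply: eq_card => -[u v]; rewrite -[(u, v)]swK mem_imset ?inE /=; last exact: can_inj swK.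
rewrite adj_sym [adj H v u]adj_sym; case: ltngtP => //= /val_inj ->.
by rewrite !adj_irr.
Qed.

Lemma edit_dist_pull h G H : edit_dist (pull h G) (pull h H) = edit_dist G H.
Proof.
apply: double_inj; rewrite !double_edit_dist.
pose hh (e : 'I_n * 'I_n) := (h e.1, h e.2).
have hh_inj : injective hh by move=> [u v] [u' v'] [/perm_inj-> /perm_inj->].
rewrite -(card_imset _ hh_inj); apply: eq_card => -[u v].
have -> : (u, v) = hh (h^-1 u, h^-1 v)%g by rewrite /hh /= !permKV.
by rewrite mem_imset // !inE /= !adj_pull.
Qed.

Lemma family_pull (P : graph_family) h G : iso_closed P -> P n G -> P n (pull h G).
Proof.
move=> isoP; apply: isoP; exists (h^-1)%g.
by have := pull_isomorphism h^-1 (pull h G); rewrite pullK.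
Qed.

Lemma far_pull (R : realType) d (eps : R) (P : graph_family) h G :
  iso_closed P -> far d eps P n G -> far d eps P n (pull h G).
Proof.
move=> isoP [bG farG]; split; first exact: pull_bounded.
move=> H PH; rewrite -(edit_dist_pull h^-1) pullK; apply: farG.
exact: family_pull.
Qed.

End Pull.

(** * Balls, local agreement and local isomorphisms *)

Section Balls.
Variable n : nat.
Implicit Types (G H : sgraph n) (h tau : {perm 'I_n}) (u v w : 'I_n).

Lemma ballP G t v w :
  reflect (exists p, [/\ (size p <= t)%N, path (adj G) v p & last v p = w])
          (w \in ball G t v).
Proof.
rewrite inE; apply: (iffP existsP) => [[k /existsP[p /andP[vp /eqP pw]]]|].
  by exists p; rewrite size_tuple -ltnS ltn_ord.
move=> [p [szp vp pw]]; exists (Ordinal (szp : (size p < t.+1)%N)).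
by apply/existsP; exists (in_tuple p); rewrite vp pw eqxx.
Qed.

Lemma ball_mono G s t v : (s <= t)%N -> ball G s v \subset ball G t v.
Proof.
move=> st; apply/subsetP => w /ballP[p [szp vp pw]].
by apply/ballP; exists p; split=> //; apply: leq_trans st.
Qed.

Lemma ball0 G v : ball G 0 v = [set v].
Proof.
apply/setP => w; rewrite in_set1; apply/ballP/eqP => [[p []]|->]; last by exists [::].
by rewrite leqn0 => /nilP-> _ <-.
Qed.

Lemma ball_trans G s t u v w :
  v \in ball G s u -> w \in ball G t v -> w \in ball G (s + t) u.
Proof.
move=> /ballP[p [szp up <-]] /ballP[p' [szp' vp' <-]].
apply/ballP; exists (p ++ p').
by rewrite size_cat leq_add // cat_path up vp' last_cat.
Qed.

Lemma ball_adj G v w : adj G v w -> w \in ball G 1 v.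
Proof. by move=> vw; apply/ballP; exists [:: w]; rewrite /= vw. Qed.

Lemma ball_sym G t v w : (w \in ball G t v) = (v \in ball G t w).
Proof.
suff H a b : b \in ball G t a -> a \in ball G t b by apply/idP/idP; apply: H.
move=> /ballP[p [szp ap <-]]; apply/ballP; exists (rev (belast a p)).
rewrite size_rev size_belast szp; split=> //.
  by rewrite rev_path (@eq_path _ _ (adj G)) // => x y; rewrite adj_sym.
by case: p {szp ap} => //= x p; rewrite rev_cons last_rcons.
Qed.

Lemma ballSr G t v w :
  w \in ball G t.+1 v -> w = v \/ exists2 u, u \in ball G t v & adj G u w.
Proof.
move=> /ballP[p]; case/lastP: p => [|p z] [szp vp <-]; first by left.
move: szp vp; rewrite size_rcons ltnS rcons_path last_rcons => szp /andP[vp pz].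
by right; exists (last v p) => //; apply/ballP; exists p.
Qed.

(** A nonempty path continues from one of at most [d] neighbors; the root joins them for the empty
    path, hence the factor [d.+1]. *)
Lemma card_ball d G t v : bounded d G -> (#|ball G t v| <= d.+1 ^ t)%N.
Proof.
move=> bG; elim: t v => [|t IHt] v; first by rewrite ball0 cards1.
have sub : ball G t.+1 v \subset
    \bigcup_(u in v |: [set w | adj G v w]) ball G t u.
  apply/subsetP => w /ballP[[|u p] [szp vp pw]].
    apply/bigcupP; exists v; first by rewrite !inE eqxx.
    by rewrite -pw ball_root.
  move: vp => /= /andP[vu up]; apply/bigcupP; exists u.
    by rewrite !inE vu orbT.
  by apply/ballP; exists p.
apply: leq_trans (subset_leq_card sub) _.
have bigU (D : {set 'I_n}) :
    (#|\bigcup_(u in D) ball G t u| <= \sum_(u in D) #|ball G t u|)%N.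
  elim/big_rec2: _ => [|u k S _ leSk]; first by rewrite cards0.
  by rewrite cardsU (leq_trans (leq_subr _ _)) // leq_add2l.
apply: leq_trans (bigU _) _.
apply: (@leq_trans (\sum_(u in v |: [set w | adj G v w]) d.+1 ^ t)).
  by apply: leq_sum.
rewrite sum_nat_const expnS leq_mul2r; apply/orP; right.
by rewrite cardsU1 -add1n leq_add // leq_b1.
Qed.

Lemma mem_ball_pull h G t v w :
  (w \in ball (pull h G) t v) = (h w \in ball G t (h v)).
Proof.
suff H k H0 a b : b \in ball (pull k H0) t a -> k b \in ball H0 t (k a).
  apply/idP/idP; first exact: H.
  by move=> hw; have := @H h^-1%g (pull h G) (h v) (h w); rewrite pullK !permK; apply.
move=> /ballP[p [szp ap <-]]; apply/ballP; exists (map k p).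
rewrite size_map last_map; split=> //.
by rewrite path_map (@eq_path _ _ (adj (pull k H0))) // => x y; rewrite adj_pull.
Qed.

(** Only one endpoint has to lie in [D], so agreement also covers the edges leaving [D]. This is
    what gains one radius in [agree_ball]. *)
Definition agree G H (D : {set 'I_n}) :=
  forall u v, u \in D -> adj H u v = adj G u v.

Lemma agree_sub G H (D E : {set 'I_n}) : D \subset E -> agree G H E -> agree G H D.
Proof. by move=> /subsetP DE GH u v /DE; apply: GH. Qed.

Lemma agree_ball G H t v :
  agree G H (ball G t v) -> ball G t.+1 v \subset ball H t.+1 v.
Proof.
move=> GH; elim: {-2}t.+1 (leqnn t.+1) => [|k IHk] kt; first by rewrite !ball0.
apply/subsetP => w /ballSr[->|[u uk uw]]; first exact: ball_root.
rewrite -addn1; apply: (@ball_trans _ _ _ _ u).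
  by have /subsetP := IHk (ltnW kt); apply.
by apply: ball_adj; rewrite GH //; apply: (subsetP (ball_mono _ _ _)) uk.
Qed.

Lemma agree_ball_eq G H t v :
  agree G H (ball G t v) -> ball H t.+1 v = ball G t.+1 v.
Proof.
move=> GH; apply/eqP; rewrite eqEsubset; apply/andP; split; last exact: agree_ball.
elim: {-2}t.+1 (leqnn t.+1) => [|k IHk] kt; first by rewrite !ball0.
apply/subsetP => w /ballSr[->|[u uk uw]]; first exact: ball_root.
have {}uk : u \in ball G k v by have /subsetP := IHk (ltnW kt); apply.
rewrite -addn1; apply: (@ball_trans _ _ _ _ u) => //.
by apply: ball_adj; rewrite -GH //; apply: (subsetP (ball_mono _ _ _)) uk.
Qed.

(** The values of [tau] outside [E] do not matter: on [E] it already takes the values [h z] for all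
    neighbors [z] of [u], so by injectivity it sends no other vertex next to [h u]. *)
Lemma agree_pull_ext G G' h tau (D E : {set 'I_n}) :
    agree G (pull h G') D -> D \subset E ->
    (forall u w, u \in D -> adj G u w -> w \in E) -> {in E, tau =1 h} ->
  agree G (pull tau G') D.
Proof.
move=> GhG' /subsetP DE NE tauh u w uD; rewrite adj_pull (tauh _ (DE _ uD)).
have tauw : adj G' (h u) (tau w) = adj G u (h^-1 (tau w))%g.
  by rewrite -GhG' // adj_pull permKV.
rewrite tauw; apply/idP/idP => uw; last by rewrite tauh ?permK //; apply: NE uw.
have := tauh _ (NE _ _ uD uw); rewrite permKV => /perm_inj eqw.
by move: uw; rewrite eqw.
Qed.

Lemma adj_ballS G t v u w : u \in ball G t v -> adj G u w -> w \in ball G t.+1 v.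
Proof. by move=> uv uw; rewrite -addn1; apply: ball_trans uv (ball_adj uw). Qed.

(* [h] is an isomorphism from the [r.+1]-ball of [v] onto that of [v'], up to
   edges between two vertices at distance exactly [r.+1] from the root. *)
Definition loc_iso r G v G' v' h : Prop :=
  h v = v' /\ agree G (pull h G') (ball G r v).

(* The relabelling [tau] of [G'] moves the neighborhood of [v'] to [v] and keeps
   the neighborhoods on which [G] and [G'] agree. *)
Lemma splice_loc_iso r G G' h (v : 'I_n) (s : seq 'I_n) :
    agree G (pull h G') (ball G r v) ->
    (forall a, a \in s -> agree G G' (ball G r a)) ->
    (forall a, a \in s -> v \notin ball G (r.+1 + r.+1) a) ->
    (forall a, a \in s -> h v \notin ball G' (r.+1 + r.+1) a) ->
  exists tau, [/\ tau v = h v, {in s, forall a, tau a = a},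
    agree G (pull tau G') (ball G r v) &
    forall a, a \in s -> agree G (pull tau G') (ball G r a)].
Proof.
move=> hv sG farG farG'.
pose B := \bigcup_(a in s) ball G r.+1 a.
pose D := ball G r.+1 v :|: B.
(* This glues [h] near [v] to the identity near [s]; it is injective on [D] because neither the ball
   of [v] nor its image under [h] meets [B]. *)
pose f u := if u \in ball G r.+1 v then h u else u.
have notB u : u \in ball G r.+1 v -> u \notin B.
  move=> uv; apply/bigcupP => -[a a_s ua]; apply/negP: (farG a a_s).
  by rewrite negbK; apply: ball_trans ua _; rewrite ball_sym.
(* [B] is built from balls of [G]; by agreement they are balls of [G'] too, where [farG']
   applies. *)
have hnotB u : u \in ball G r.+1 v -> h u \notin B.
  move=> uv; apply/bigcupP => -[a a_s hua]; apply/negP: (farG' a a_s).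
  rewrite negbK; apply: (@ball_trans _ _ _ _ (h u)).
    by rewrite (agree_ball_eq (sG a a_s)).
  by rewrite ball_sym -mem_ball_pull (subsetP (agree_ball hv)).
have f_inj : {in D &, injective f}.
  move=> u w; rewrite !in_setU /f.
  case: ifP => uv; case: ifP => wv /=.
  - by move=> _ _ /perm_inj.
  - by move=> _ wB hu; case/negP: (hnotB _ uv); rewrite hu.
  - by move=> uB _ uh; case/negP: (hnotB _ wv); rewrite -uh.
  - by [].
have [tau tauf] := perm_extend f_inj.
have tauv : {in ball G r.+1 v, tau =1 h}.
  by move=> u uv; rewrite tauf ?in_setU ?uv // /f uv.
have taua : {in B, tau =1 (1%g : {perm 'I_n})}.
  move=> u uB; rewrite tauf ?in_setU ?uB ?orbT // /f perm1.
  by case: ifP => // /notB; rewrite uB.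
exists tau; split.
- by rewrite tauv ?ball_root.
- move=> a a_s; rewrite taua ?perm1 //; apply/bigcupP; exists a => //.
  exact: ball_root.
- apply: (agree_pull_ext hv) tauv; first exact: ball_mono.
  by move=> u w; apply: adj_ballS.
- move=> a a_s; apply: (@agree_pull_ext _ _ 1%g _ _ (ball G r.+1 a)).
  + by rewrite pull1; apply: sG.
  + exact: ball_mono.
  + by move=> u w; apply: adj_ballS.
  + by move=> u ua; apply: taua; apply/bigcupP; exists a.
Qed.

(** A disc isomorphism controls only edges inside the [t]-ball; [r < t] puts all neighbors of the
    [r]-ball inside it. *)
Lemma disc_loc_iso r t G v G' v' :
    (r < t)%N -> disc_type G t v = disc_type G' t v' ->
  exists h, loc_iso r G v G' v' h.
Proof.
move=> rt /eqquotP/asboolP[f /= [[[f' fK f'K] fadj] froot]].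
pose B := ball G t v; pose B' := ball G' t v'.
(* This is [f] read on vertices; outside [B] it takes a default value, so only its restriction to
   [B] is meaningful. *)
pose g (u : 'I_n) : 'I_n := enum_val (f (enum_rank_in (ball_root G t v) u)).
have g_ball u : g u \in B' by apply: enum_valP.
have g_inj : {in B &, injective g}.
  by move=> u w uB wB /enum_val_inj/(can_inj fK)/enum_rank_in_inj; apply.
have g_root : g v = v' by rewrite /g froot enum_rankK_in ?ball_root.
have g_adj u w : u \in B -> w \in B -> adj G' (g u) (g w) = adj G u w.
  move=> uB wB.
  have := fadj (enum_rank_in (ball_root G t v) u) (enum_rank_in (ball_root G t v) w).
  by rewrite /adj !inE /= !enum_rankK_in.
have g_onto w' : w' \in B' -> exists2 w, w \in B & g w = w'.
  move=> wB'; exists (enum_val (f' (enum_rank_in (ball_root G' t v') w'))).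
    exact: enum_valP.
  by rewrite /g enum_valK_in f'K enum_rankK_in.
have g_dist k u : (k <= t)%N -> u \in ball G k v -> g u \in ball G' k v'.
  elim: k u => [|k IHk] u kt; first by rewrite !ball0 !inE => /eqP->; apply/eqP.
  move=> /[dup] uk /ballSr[->|[w wk wu]]; first by rewrite g_root ball_root.
  apply: adj_ballS (IHk w (ltnW kt) wk) _; rewrite g_adj //.
    exact: (subsetP (ball_mono _ _ (ltnW kt))) wk.
  exact: (subsetP (ball_mono _ _ kt)) uk.
have [h hg] := perm_extend g_inj.
exists h; split=> [|u w ur]; first by rewrite hg ?ball_root.
have uB : u \in B by exact: (subsetP (ball_mono _ _ (ltnW rt))) ur.
rewrite adj_pull hg //; have [wB|wB] := boolP (w \in B).
  by rewrite hg // g_adj.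
(* For [w] outside the disc both adjacencies fail: a neighbor of [h u] lies in [B'], hence is the
   image of a vertex of [B]. *)
rewrite [RHS](contraNF _ wB); last first.
  by move=> uw; apply: (subsetP (ball_mono _ _ rt)) (adj_ballS ur uw).
apply: (contraNF _ wB) => uw.
have hwB' : h w \in B'.
  apply: (subsetP (ball_mono _ _ rt)); apply: adj_ballS uw.
  exact: g_dist (ltnW rt) ur.
have [w0 w0B] := g_onto _ hwB'; rewrite -hg // => /perm_inj <- //.
Qed.

End Balls.

(** * Decision trees, majority votes and simulation under a relabelling *)

Section QueryTrees.
Variables n d : nat.
Implicit Types (O : oracle n d) (T : dtree n d) (p : {perm 'I_n}).

Definition sorted_oracle (G : sgraph n) : oracle n d :=
  fun u i => onth (enum (adj G u)) i.

Lemma sorted_oracleP G : represents (sorted_oracle G) G.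
Proof.
by move=> u; exists (enum (adj G u)); split=> // [|v]; rewrite ?enum_uniq ?mem_enum.
Qed.

(* Trees may be deep outside valid oracles; cutting the runs allows induction on
   the number of queries. *)
Fixpoint runf (r : nat) T O : bool :=
  match T, r with
  | Output b, _ => b
  | Query _ _ _, 0%N => false
  | Query u i k, r'.+1 => runf r' (k (O u i)) O
  end.

Lemma runf_run r T O : (num_queries T O <= r)%N -> runf r T O = run T O.
Proof. by elim: r T => [|r IHr] [b|u i k] //=; rewrite ltnS; apply: IHr. Qed.

Fixpoint tbind T (f : bool -> dtree n d) : dtree n d :=
  match T with
  | Output b => f b
  | Query u i k => Query u i (fun a => tbind (k a) f)
  end.

Lemma run_tbind T f O : run (tbind T f) O = run (f (run T O)) O.
Proof. by elim: T => //= u i k IHk; apply: IHk. Qed.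

Lemma num_queries_tbind T f O :
  num_queries (tbind T f) O = (num_queries T O + num_queries (f (run T O)) O)%N.
Proof. by elim: T => //= u i k IHk; rewrite IHk addSn. Qed.

Definition majority (a b c : bool) := [|| a && b, a && c | b && c].

Definition tmajority T1 T2 T3 : dtree n d :=
  tbind T1 (fun a => tbind T2 (fun b =>
    tbind T3 (fun c => Output n d (majority a b c)))).

Lemma run_tmajority T1 T2 T3 O :
  run (tmajority T1 T2 T3) O = majority (run T1 O) (run T2 O) (run T3 O).
Proof. by rewrite !run_tbind. Qed.

Lemma num_queries_tmajority T1 T2 T3 O :
  num_queries (tmajority T1 T2 T3) O =
    (num_queries T1 O + num_queries T2 O + num_queries T3 O)%N.
Proof. by rewrite !num_queries_tbind /= addn0 addnA. Qed.

Fixpoint ask (v : 'I_n) (js : seq 'I_d) (acc : seq (option 'I_n))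
    (k : seq (option 'I_n) -> dtree n d) : dtree n d :=
  match js with
  | [::] => k acc
  | j :: js' => Query v j (fun a => ask v js' (rcons acc a) k)
  end.

Lemma run_ask v js acc k O :
  run (ask v js acc k) O = run (k (acc ++ map (O v) js)) O.
Proof. by elim: js acc => [|j js IHjs] acc /=; rewrite ?cats0 // IHjs cat_rcons. Qed.

Lemma num_queries_ask v js acc k O :
  num_queries (ask v js acc k) O =
    (size js + num_queries (k (acc ++ map (O v) js)) O)%N.
Proof.
by elim: js acc => [|j js IHjs] acc /=; rewrite ?cats0 // IHjs cat_rcons addSn.
Qed.

(* Sorting the neighbors by name, in [pull p G], requires listing all of them; hence
   [d] queries to [G] for each simulated one. *)
Fixpoint simulate (p : {perm 'I_n}) T : dtree n d :=
  match T with
  | Output b => Output n d b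
  | Query u i k => ask (p u) (enum 'I_d) [::]
      (fun s => simulate p (k (onth (enum [pred y | Some (p y) \in s]) i)))
  end.

(** The degree bound makes the [d] slots exhaust the neighbors, and enumerating them afresh forgets
    the order chosen by [O]. *)
Lemma simulate_answer p G O u i : bounded d G -> represents O G ->
  onth (enum [pred y | Some (p y) \in map (O (p u)) (enum 'I_d)]) i =
    onth (enum (adj (pull p G) u)) i.
Proof.
move=> bG repO; congr onth; apply: eq_enum => y; rewrite inE.
rewrite [RHS](adj_pull p G u y).
have [s [uniqs s_adj Os]] := repO (p u).
have szs : (size s <= d)%N.
  rewrite -(card_uniqP uniqs); apply: leq_trans (bG (p u)).
  by apply: subset_leq_card; apply/subsetP => w; rewrite s_adj inE.
have -> : adj G (p u) (p y) = (p y \in s) by rewrite s_adj.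
apply/mapP/onthP => [[j _ ->]|[j sj]]; first by exists j; rewrite Os.
have jd : (j < d)%N by apply: leq_trans szs; rewrite -onthTE sj.
by exists (Ordinal jd); rewrite ?mem_enum // Os sj.
Qed.

Lemma run_simulate p G O T : bounded d G -> represents O G ->
  run (simulate p T) O = run T (sorted_oracle (pull p G)).
Proof.
move=> bG repO; elim: T => //= u i k IHk.
by rewrite run_ask (simulate_answer _ _ _ bG repO) IHk.
Qed.

Lemma num_queries_simulate p G O T : bounded d G -> represents O G ->
  num_queries (simulate p T) O = (d * num_queries T (sorted_oracle (pull p G)))%N.
Proof.
move=> bG repO; elim: T => /= [_|u i k IHk]; first by rewrite muln0.
rewrite num_queries_ask (simulate_answer _ _ _ bG repO) IHk.
by rewrite size_enum_ord mulnS.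
Qed.

End QueryTrees.

(** * Coupling the runs on two locally similar graphs *)

Section Coupling.
Variables (R : realType) (n d : nat).
Implicit Types (G : sgraph n) (p h tau phi : {perm 'I_n}).
Implicit Types (s : seq ('I_n * 'I_n)) (F : {perm 'I_n} -> R).

(* [s] is a partial labelling: a list of pairs of a label and the vertex that
   carries it. *)
Definition completions s : {set {perm 'I_n}} :=
  [set p : {perm 'I_n} | all (fun e => p e.1 == e.2) s].

Lemma completions_cons x v s p :
  (p \in completions ((x, v) :: s)) = (p x == v) && (p \in completions s).
Proof. by rewrite !inE. Qed.

Lemma sum_completions_label x s F :
  \sum_(p in completions s) F p =
    \sum_v \sum_(p in completions ((x, v) :: s)) F p.
Proof.
rewrite (partition_big (fun p => p x) predT) //=; apply: eq_bigr => v _.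
by apply: eq_bigl => p; rewrite completions_cons andbC.
Qed.

Lemma sum_completions_vertex u s F :
  \sum_(p in completions s) F p =
    \sum_y \sum_(p in completions ((y, u) :: s)) F p.
Proof.
rewrite (partition_big (fun p => (p^-1)%g u) predT) //=; apply: eq_bigr => y _.
apply: eq_bigl => p; rewrite completions_cons andbC; congr (_ && _).
by apply/eqP/eqP => <-; rewrite ?permKV ?permK.
Qed.

Lemma card_completions_sum s : #|completions s|%:R = \sum_(p in completions s) (1 : R).
Proof. by rewrite sumr_const. Qed.

(** Split by the labels that the vertices [us] receive: a bound proportional to the number of
    completions adds up over the cases. *)
Lemma reveal_vertices (eta : R) us s F :
    (forall s', map snd s' = us ->
       `|\sum_(p in completions (s' ++ s)) F p| <= eta * #|completions (s' ++ s)|%:R) ->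
  `|\sum_(p in completions s) F p| <= eta * #|completions s|%:R.
Proof.
elim: us s => [|u us IHus] s Hs; first exact: (Hs [::]).
rewrite (sum_completions_vertex u) (card_completions_sum s).
rewrite (sum_completions_vertex u) mulr_sumr.
apply: le_trans (ler_norm_sum _ _ _) _; apply: ler_sum => y _.
rewrite -card_completions_sum; apply: IHus => s' s'us.
have -> : completions (s' ++ (y, u) :: s) = completions (((y, u) :: s') ++ s).
  by apply/setP => p; rewrite !inE /= !all_cat /= andbCA.
by apply: Hs; rewrite /= s'us.
Qed.

(** Right multiplication by [tau] respects the recorded labels, whose vertices it fixes. It trades a
    change of the vertex carrying [x] for a relabelling of the graph. *)
Lemma sum_completions_perm tau s F : {in map snd s, forall a, tau a = a} ->
  forall x v, \sum_(p in completions ((x, tau v) :: s)) F p =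
    \sum_(p in completions ((x, v) :: s)) F (p * tau)%g.
Proof.
move=> taus x v.
rewrite (reindex_inj (mulIg tau)) /=; apply: eq_bigl => p.
rewrite !inE /= permM (inj_eq perm_inj); congr (_ && _).
apply: eq_in_all => e es; rewrite permM.
by rewrite -{1}(taus e.2) ?map_f // (inj_eq perm_inj).
Qed.

(* Up to composition with transpositions, all vertices not yet labelled are
   equally likely to carry a fresh label. *)
Lemma card_completions_fresh x s : x \notin map fst s ->
  exists m : nat, (forall v, #|completions ((x, v) :: s)| <= m)%N /\
    ((n - size s) * m <= #|completions s|)%N.
Proof.
move=> xs.
have [v0 _ v0_max] := @arg_maxnP _ x xpredT (fun v => #|completions ((x, v) :: s)|) isT.
exists #|completions ((x, v0) :: s)|; split=> [v|]; first exact: v0_max.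
have [->|] := posnP #|completions ((x, v0) :: s)|; first by rewrite muln0.
pose A := [set v | v \in map snd s].
move=> /card_gt0P[p0]; rewrite completions_cons => /andP[/eqP p0x p0s].
have v0A : v0 \notin A.
  rewrite inE; apply: contra xs => /mapP[e es]; rewrite -p0x => p0x'.
  move: p0s; rewrite inE => /allP/(_ e es); rewrite -p0x' => /eqP/perm_inj <-.
  exact: map_f.
have cardv v : v \notin A ->
    #|completions ((x, v) :: s)| = #|completions ((x, v0) :: s)|.
  move=> vA; apply/eqP; rewrite -(eqr_nat R) !card_completions_sum.
  have := @sum_completions_perm (tperm v v0) s (fun=> 1) _ x v.
  rewrite tpermL => -> // a a_s; have aA : a \in A by rewrite inE.
  rewrite tpermD //; first by apply: contraNneq vA => ->.
  by apply: contraNneq v0A => ->.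
have cardA : (#|A| <= size s)%N.
  by rewrite cardsE (leq_trans (card_size _)) ?size_map.
apply: (@leq_trans (\sum_(v in ~: A) #|completions ((x, v0) :: s)|)).
  rewrite sum_nat_const leq_mul2r; apply/orP; right.
  by rewrite cardsCs setCK card_ord leq_sub2l.
have -> : #|completions s| = (\sum_v #|completions ((x, v) :: s)|)%N.
  rewrite -sum1_card (partition_big (fun p => p x) predT) //=; apply: eq_bigr => v _.
  by rewrite -sum1_card; apply: eq_bigl => p; rewrite completions_cons andbC.
rewrite [X in (_ <= X)%N](bigID (mem (~: A))) /=.
apply: leq_trans (leq_addr _ _); apply: leq_sum => v; rewrite in_setC => /cardv ->.
exact: leqnn.
Qed.

(** [phi] need not preserve edges: each matched pair has its own local isomorphism [h]. *)
Definition similar (Q Delta : nat) G G' : Prop :=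
  exists phi, (#|[set v | ~~ `[< exists h, loc_iso Q G v G' (phi v) h >]]| <= Delta)%N.

Lemma similar_pull Q Delta G G' tau :
  similar Q Delta G G' -> similar Q Delta G (pull tau G').
Proof.
move=> [phi phiD]; exists (phi * tau^-1)%g; apply: leq_trans phiD.
apply: subset_leq_card; apply/subsetP => v; rewrite !inE.
apply: contra => /asboolP[h [hv hG]]; apply/asboolP; exists (h * tau^-1)%g.
by split; [rewrite !permM hv | rewrite pullM pullK].
Qed.

Definition accepted r (T : dtree n d) G p : R :=
  (runf r T (sorted_oracle (pull p G)))%:R.

Lemma accepted_pull r T G tau p : accepted r T (pull tau G) p = accepted r T G (p * tau)%g.
Proof. by rewrite /accepted pullM. Qed.

Definition agree_around r G G' s := forall e, e \in s -> agree G G' (ball G r e.2).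

(** Once all neighbors of [v] carry labels, the answer at [x] is the same for every completion, so
    the run continues in one fixed subtree. *)
Lemma enum_adj_pull G s x v s' p :
    (x, v) \in s -> map snd s' = enum (adj G v) -> p \in completions (s' ++ s) ->
  enum (adj (pull p G) x) = enum (mem (map fst s')).
Proof.
move=> xvs s'v; rewrite inE all_cat => /andP[/allP ps' /allP /(_ _ xvs)/= /eqP px].
apply: eq_enum => y; rewrite [LHS](adj_pull p G x y) px.
have -> : adj G v (p y) = (p y \in map snd s') by rewrite s'v mem_enum.
apply/mapP/mapP => -[e es' ey]; exists e => //; have := ps' _ es'.
  by rewrite -ey => /eqP/perm_inj.
by rewrite -ey eq_sym => /eqP.
Qed.

Lemma size_enum_adj G v : bounded d G -> (size (enum (adj G v)) <= d)%N.
Proof.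
by move=> bG; rewrite -cardE; apply: leq_trans (bG v); rewrite cardsE.
Qed.

Section Step.
Variables (e : R) (K Q Delta : nat).
Hypothesis e_ge0 : 0 <= e.
(* The loss [e] of one fresh query: at most [K] vertices are exposed, the first
   term counts the vertices near them in either graph, the second the badly matched
   vertices. *)
Hypothesis e_bound :
  (2 * K * d.+1 ^ (2 * Q.+1) + Delta)%:R <= e * (n - K)%:R.

(** The agreement radius is the number [r] of queries left. Each may expose a vertex and its at most
    [d] neighbors, whence [d.+1 * r]. The graphs are quantified because [G'] gets relabelled along
    the way. *)
Definition coupled r := forall T s G G',
  bounded d G -> bounded d G' -> (r <= Q)%N -> (size s + d.+1 * r <= K)%N ->
  agree_around r G G' s -> similar Q Delta G G' ->
  `|\sum_(p in completions s) (accepted r T G p - accepted r T G' p)|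
    <= r%:R * e * #|completions s|%:R.

(** Nothing is lost, whence [r] and not [r.+1] in the bound: both graphs give [v] the same
    neighbors, and after revealing their labels the answers coincide. Around these neighbors the
    agreement radius drops by one. *)
Lemma coupled_known r x i k s v : coupled r -> (x, v) \in s -> forall G G',
  bounded d G -> bounded d G' -> (r.+1 <= Q)%N -> (size s + d + d.+1 * r <= K)%N ->
  agree_around r.+1 G G' s -> similar Q Delta G G' ->
  `|\sum_(p in completions s)
      (accepted r.+1 (Query x i k) G p - accepted r.+1 (Query x i k) G' p)|
    <= r%:R * e * #|completions s|%:R.
Proof.
move=> IHr xvs G G' bG bG' rQ szs agr sim.
apply: (@reveal_vertices _ (enum (adj G v))) => s' s'v.
have adjG' : enum (adj G v) = enum (adj G' v).
  by apply: eq_enum => w; rewrite -[LHS](agr _ xvs) ?ball_root.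
pose T := k (onth (enum (mem (map fst s'))) i).
rewrite (eq_bigr (fun p => accepted r T G p - accepted r T G' p)); last first.
  move=> p ps; rewrite /accepted /= /sorted_oracle.
  rewrite (enum_adj_pull xvs s'v ps) (enum_adj_pull xvs _ ps) //.
  by rewrite s'v.
apply: IHr => //; first exact: ltnW.
- rewrite size_cat -(size_map snd) s'v; apply: leq_trans szs.
  by rewrite leq_add2r addnC leq_add2l size_enum_adj.
- move=> a; rewrite mem_cat => /orP[as'|a_s]; last first.
    by apply: agree_sub (agr _ a_s); apply: ball_mono.
  apply: agree_sub (agr _ xvs); apply/subsetP => w wa /=.
  rewrite -add1n; apply: ball_trans (ball_adj _) wa.
  have : a.2 \in map snd s' by apply: map_f.
  by rewrite s'v mem_enum.
Qed.

(** The identity for [phi] serves the vertices near the exposed ones in [G]; the matching serves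
    those whose partner is near them in [G']. *)
Lemma card_near r G s phi : bounded d G -> (r <= Q)%N -> (size s <= K)%N ->
  (#|[set v | has (fun a => phi v \in ball G (r.+1 + r.+1) a.2) s]|
     <= K * d.+1 ^ (2 * Q.+1))%N.
Proof.
move=> bG rQ sK.
apply: (@leq_trans (size s * d.+1 ^ (2 * Q.+1))); last by rewrite leq_mul2r sK orbT.
elim: s {sK} => [|a s IHs] /=.
  by rewrite leqn0 cards_eq0; apply/eqP/setP => v; rewrite !inE.
have setOr (P P' : pred 'I_n) : [set v | P v || P' v] = [set v | P v] :|: [set v | P' v].
  by apply/setP => v; rewrite !inE.
rewrite setOr cardsU (leq_trans (leq_subr _ _)) // mulSn leq_add //.
rewrite -(card_imset _ (@perm_inj _ phi)).
apply: (@leq_trans #|ball G (r.+1 + r.+1) a.2|).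
  apply: subset_leq_card; apply/subsetP => _ /imsetP[v + ->].
  by move=> va; have := va; rewrite in_set.
apply: leq_trans (card_ball _ _ bG) _.
by rewrite leq_pexp2l // addnn -mul2n leq_mul2l.
Qed.

(** Compare the case that [v] carries [x] in [G] with the case that [phi v] does in [G']. Good [v]
    reduce to a known label; each bad [v] costs at most [m], in total one further [e]. *)
Lemma coupled_fresh r x i k s : coupled r -> x \notin map fst s -> forall G G',
  bounded d G -> bounded d G' -> (r.+1 <= Q)%N -> (size s + d.+1 * r.+1 <= K)%N ->
  agree_around r.+1 G G' s -> similar Q Delta G G' ->
  `|\sum_(p in completions s)
      (accepted r.+1 (Query x i k) G p - accepted r.+1 (Query x i k) G' p)|
    <= r.+1%:R * e * #|completions s|%:R.
Proof.
move=> IHr xs G G' bG bG' rQ szs agr sim.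
have [m [m_max m_fresh]] := card_completions_fresh xs.
have [phi phiD] := sim.
pose T := Query x i k.
(* Splicing with agreement radius [r.+1] needs disjoint balls of radius [r.+2]. *)
pose bad1 := [set v | has (fun a => (1%g : {perm 'I_n}) v \in ball G (r.+2 + r.+2) a.2) s].
pose bad2 := [set v | has (fun a => phi v \in ball G' (r.+2 + r.+2) a.2) s].
pose bad3 := [set v | ~~ `[< exists h, loc_iso Q G v G' (phi v) h >]].
pose bad := bad1 :|: bad2 :|: bad3.
have sK : (size s <= K)%N by apply: leq_trans szs; apply: leq_addr.
have card_bad : (#|bad| <= 2 * K * d.+1 ^ (2 * Q.+1) + Delta)%N.
  rewrite /bad cardsU (leq_trans (leq_subr _ _)) // leq_add //.
  rewrite cardsU (leq_trans (leq_subr _ _)) // -mulnA mul2n -addnn.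
  by rewrite leq_add // card_near.
have bad_loss : #|bad|%:R * m%:R <= e * #|completions s|%:R.
  apply: le_trans (_ : e * ((n - K) * m)%:R <= _).
    rewrite natrM mulrA; apply: ler_wpM2r => //.
    by apply: le_trans e_bound; rewrite ler_nat.
  rewrite ler_wpM2l // ler_nat; apply: leq_trans m_fresh.
  by rewrite leq_mul2r leq_sub2l ?orbT.
have acc01 G0 p : 0 <= accepted r.+1 T G0 p <= 1.
  by rewrite /accepted; case: runf; rewrite /= ?lexx ?ler01.
have accL G0 v : 0 <= \sum_(p in completions ((x, v) :: s)) accepted r.+1 T G0 p <= m%:R.
  apply/andP; split; first by apply: sumr_ge0 => p _; case/andP: (acc01 G0 p).
  apply: le_trans (_ : #|completions ((x, v) :: s)|%:R <= _); last by rewrite ler_nat.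
  by rewrite card_completions_sum; apply: ler_sum => p _; case/andP: (acc01 G0 p).
rewrite sumrB (sum_completions_label x s (accepted _ _ G)).
rewrite (sum_completions_label x s (accepted _ _ G')).
rewrite [X in _ - X](reindex_inj (@perm_inj _ phi)) /= -sumrB.
have pointwise v :
    `|\sum_(p in completions ((x, v) :: s)) accepted r.+1 T G p -
      \sum_(p in completions ((x, phi v) :: s)) accepted r.+1 T G' p| <=
    r%:R * e * #|completions ((x, v) :: s)|%:R + (v \in bad)%:R * m%:R.
  have [vbad|] := boolP (v \in bad).
    rewrite mul1r ler_wpDl ?mulr_ge0 //.
    by move: (accL G v) (accL G' (phi v)); rewrite ler_norml => /andP[? ?] /andP[? ?]; lra.
  rewrite !in_setU !negb_or mul0r addr0 => /andP[/andP[v1 v2] v3].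
  move: v1; rewrite in_set => /hasPn v1; move: v2; rewrite in_set => /hasPn v2.
  move: v3; rewrite in_set negbK => /asboolP[h [hv hG]].
  have [||||tau [tauv taus tauG agrs]] := @splice_loc_iso _ r.+1 G G' h v (map snd s).
  - by apply: agree_sub hG; apply: ball_mono.
  - by move=> _ /mapP[a a_s ->]; apply: agr.
  - by move=> _ /mapP[a a_s ->]; have := v1 _ a_s; rewrite perm1.
  - by move=> _ /mapP[a a_s ->]; rewrite hv; apply: v2.
  (* As [tau v = phi v], the second sum becomes one over labellings giving [x] to [v] itself, for
     the graph [pull tau G']. *)
  rewrite -hv -tauv (sum_completions_perm _ taus).
  under [X in _ - X]eq_bigr do rewrite -accepted_pull.
  rewrite -sumrB; apply: (coupled_known i k IHr (mem_head (x, v) s)) => //.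
  - exact: pull_bounded.
  - by rewrite /= addSnnS -addnA [(d.+1 + _)%N]addnC addnC -mulnSr [X in (X <= _)%N]addnC.
  - by move=> a; rewrite inE => /orP[/eqP->|/(map_f snd)/agrs].
  - exact: similar_pull.
apply: le_trans (ler_norm_sum _ _ _) _.
apply: le_trans (ler_sum _ (fun v _ => pointwise v)) _.
rewrite big_split /= -mulr_sumr -mulr_suml.
have -> : \sum_v #|completions ((x, v) :: s)|%:R = #|completions s|%:R :> R.
  rewrite [RHS]card_completions_sum (sum_completions_label x).
  by apply: eq_bigr => v _; rewrite card_completions_sum.
have -> : \sum_v (v \in bad)%:R = #|bad|%:R :> R.
  by rewrite -natr_sum -sum1_card -big_mkcond.
rewrite -[r.+1]addn1 natrD mulrDl mulrDl mul1r.
exact: lerD.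
Qed.

Lemma coupling r : coupled r.
Proof.
elim: r => [|r IHr] [b|x i k] s G G' bG bG' rQ szs agr sim.
(* At a leaf, or with no queries left, [runf] does not look at the graph. *)
1-3: rewrite big1 ?normr0 ?mulr_ge0 //; last by move=> p _; rewrite subrr.
have [/mapP[[x' v] xvs /= ->]|xs] := boolP (x \in map fst s); last exact: coupled_fresh.
apply: le_trans (_ : r%:R * e * #|completions s|%:R <= _).
  apply: (coupled_known i k IHr xvs) => //.
  apply: leq_trans szs; rewrite -addnA leq_add2l mulnS leq_add2r.
  exact: leqnSn.
by rewrite -!mulrA ler_wpM2r ?mulr_ge0 // ler_nat.
Qed.

End Step.

End Coupling.

(** * From close frequency vectors to close acceptance counts *)

(** Matching by disc type leaves unmatched at most the positive parts of the count differences, each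
    at most [n] times a term of the distance. *)
Lemma freq_similar (R : realType) n d t Q (G H : sgraph n) :
    bounded d G -> bounded d H -> (Q < t)%N ->
  exists2 Delta : nat, similar Q Delta G H &
    Delta%:R <= freq_dist R d t G H * n%:R.
Proof.
move=> bG bH Qt.
pose U := undup (codom (disc_type G t) ++ codom (disc_type H t)).
have [|phi phiU] := @matching_perm _ _ (disc_type G t) (disc_type H t) U (undup_uniq _).
  by move=> v; rewrite mem_undup mem_cat codom_f.
exists #|[set v | disc_type G t v != disc_type H t (phi v)]|.
  exists phi; apply: subset_leq_card; apply/subsetP => v; rewrite !inE.
  by apply: contra => /eqP/(disc_loc_iso Qt) ?; apply/asboolP.
have UE (x : rtype) : x \notin U -> forall K : sgraph n, K = G \/ K = H ->
    [set v | disc_type K t v == x] = set0.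
  rewrite mem_undup mem_cat negb_or => /andP[xG xH] K KGH.
  apply/setP => v; rewrite !inE; apply/negP => /eqP vx.
  by case: KGH vx => -> vx; move: xG xH; rewrite -vx codom_f.
have -> : freq_dist R d t G H =
    \sum_(x <- U) `|freq R t G x - freq R t H x|.
  rewrite /freq_dist (fsbigop.fsbigE U) ?undup_uniq //.
  - rewrite big_seq_cond [RHS]big_seq_cond; apply: eq_bigl => x; rewrite andbT.
    have [xU|//] := boolP (x \in U); apply/classical_sets.mem_set.
    move: xU; rewrite mem_undup mem_cat => /orP[] /codomP[v ->].
      by exists n, G, v.
    by exists n, H, v.
  - move=> x /=; rewrite mem_undup mem_cat => /orP[] /codomP[v ->].
      by exists n, G, v.
    by exists n, H, v.
  - move=> x _ xU; rewrite /freq !(UE x xU) ?cards0 ?subrr ?normr0 //; by [left|right].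
apply: le_trans (_ : (\sum_(k <- U) (#|[set x | disc_type G t x == k]| -
   #|[set x | disc_type H t x == k]|))%N%:R <= _); first by rewrite ler_nat.
rewrite natr_sum mulr_suml; apply: ler_sum => k _.
have [n0|n_gt0] := posnP n.
  rewrite (_ : #|[set x | disc_type G t x == k]| = 0%N) ?sub0n ?mulr_ge0 //.
  by apply: eq_card0 => v; have := ltn_ord v; rewrite [X in (_ < X)%N]n0.
rewrite /freq -mulrBl normrM [`|n%:R^-1|]ger0_norm ?invr_ge0 // mulfVK; last first.
  by rewrite pnatr_eq0 -lt0n.
have [GH|HG] := leqP #|[set x | disc_type G t x == k]| #|[set x | disc_type H t x == k]|.
  by rewrite (eqP (GH : _ - _ == 0)%N) mulr0n normr_ge0.
by rewrite natrB ?ler_norm // ltnW.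
Qed.

(** The finite bound [b] rules out the default [+oo], so it is met by an actual member of [P]. *)
Lemma min_freq_distP (R : realType) d t n (G : sgraph n)
    (P : classical_sets.set (sgraph n)) (b : R) :
  (min_freq_dist R d t G P <= b%:E)%E -> exists2 H, P H & freq_dist R d t G H <= b.
Proof.
move=> /bigmin_leP[|[H PH]]; first by rewrite leye_eq.
by rewrite lee_fin; exists H => //; apply/asboolP.
Qed.

(** The first term of [e_bound] for [K = d.+1 * Q], the capacity that [Q] queries need from an empty
    labelling. *)
Definition near_bound (d Q : nat) := (2 * (d.+1 * Q) * d.+1 ^ (2 * Q.+1))%N.

(** With [Q = 3 * q], [K = d.+1 * Q] and [C = near_bound d Q], the first summand yields
    [n <= 2 * (n - K)] and the second [48 * Q * C <= n - K]. *)
Definition coupling_threshold (d q : nat) :=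
  (2 * (d.+1 * (3 * q)) + 48 * (3 * q) * near_bound d (3 * q)).+1.

(* The loss 1/16 is the sum of 1/24 for badly matched vertices and of 1/48 for
   vertices near the exposed region. *)
Lemma close_acceptance (R : realType) n d q (G H : sgraph n) (T : dtree n d) :
    (coupling_threshold d q <= n)%N -> bounded d G -> bounded d H ->
    freq_dist R d (12 * q) G H <= 1 / (12 * (12 * q)%:R) ->
  `|\sum_p (accepted R (3 * q) T G p - accepted R (3 * q) T H p)|
    <= 1 / 16 * #|{perm 'I_n}|%:R.
Proof.
move=> n1n bG bH; have [->|q_gt0] := posnP q.
  rewrite big1 ?normr0 ?mulr_ge0 ?invr_ge0 // => p _.
  by rewrite /accepted muln0; case: T => *; rewrite subrr.
move=> GH; have Qt : (3 * q < 12 * q)%N by rewrite ltn_pmul2r.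
have [Delta simD leD] := freq_similar R bG bH Qt.
set Q := (3 * q)%N; set K := (d.+1 * Q)%N; set C := near_bound d Q.
have [Kn CnK] : (2 * K < n)%N /\ (48 * Q * C <= n - K)%N.
  by move: n1n; rewrite /coupling_threshold -/Q -/K -/C; lia.
have nK_gt0 : 0 < (n - K)%:R :> R by rewrite ltr0n; lia.
pose e : R := (C + Delta)%:R / (n - K)%:R.
have e_ge0 : 0 <= e by rewrite divr_ge0.
have e_bound : (C + Delta)%:R <= e * (n - K)%:R.
  by rewrite /e mulfVK // gt_eqF.
have := @coupling R n d e K Q Delta e_ge0 e_bound Q T [::] G H bG bH (leqnn _).
have nil p : (p \in completions (n := n) [::]) = true by rewrite inE.
rewrite (eq_bigl _ _ nil) (eq_card nil) => /(_ (leqnn _)).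
have agr0 : agree_around Q G H [::] by [].
move=> /(_ agr0 simD).
move=> /le_trans; apply; apply: ler_wpM2r => //.
rewrite /e mulrA ler_pdivrMr // natrD mulrDr.
have q0 : 0 < q%:R :> R by rewrite ltr0n.
(* Here [3 * q * n / (12 * (12 * q)) = n / 48], which is at most [(n - K) / 24] by [n2]. *)
have QD : Q%:R * Delta%:R <= n%:R / 48 :> R.
  have : Delta%:R <= 1 / (12 * (12 * q)%:R) * n%:R :> R.
    by apply: le_trans leD _; apply: ler_wpM2r.
  rewrite /Q !natrM => /(ler_wpM2l (ltW q0)).
  rewrite [X in _ <= X -> _](_ : _ = n%:R / 144); first by lra.
  by field; rewrite gt_eqF.
have n2 : n%:R <= 2 * (n - K)%:R :> R by rewrite -natrM ler_nat; lia.
have QC : 48 * (Q%:R * C%:R) <= (n - K)%:R :> R by rewrite -!natrM ler_nat mulnA.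
by lra.
Qed.

(** * Majority amplification and the canonical tester *)

(** The cubic is the probability that at least two of three independent runs accept, each with
    probability [x]. Its value at [2 / 3] is [20 / 27], so [x - 2 / 3] factors out. *)
Lemma majority_ge (R : realFieldType) (x : R) :
  2 / 3 <= x <= 1 -> 20 / 27 <= x ^+ 2 * (3 - 2 * x).
Proof.
move=> /andP[x23 x1]; rewrite -subr_ge0.
rewrite (_ : _ - _ = (x - 2 / 3) *
  (2 * ((1 - x) * (x - 2 / 3)) + (22 / 9 - 5 / 3 * x))); last by field.
have : 0 <= (1 - x) * (x - 2 / 3) by apply: mulr_ge0; lra.
by move=> ?; apply: mulr_ge0; lra.
Qed.

Lemma majority_le (R : realFieldType) (x : R) :
  0 <= x <= 1 / 3 -> x ^+ 2 * (3 - 2 * x) <= 7 / 27.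
Proof.
move=> /andP[x0 x13]; rewrite -subr_ge0.
rewrite (_ : _ - _ = (1 / 3 - x) * (x * (7 / 3 - 2 * x) + 7 / 9)); last by field.
have : 0 <= x * (7 / 3 - 2 * x) by apply: mulr_ge0; lra.
by move=> ?; apply: mulr_ge0; lra.
Qed.

Section CanonicalTester.
Variables (R : realType) (n d : nat) (A : ralg R n d).

Let seed3 := (seed A * seed A * seed A)%type.
Let weight3 (w : seed3) : R := weight A w.1.1 * weight A w.1.2 * weight A w.2.
Let tree3 (w : seed3) : dtree n d :=
  tmajority (strategy A w.1.1) (strategy A w.1.2) (strategy A w.2).

Lemma sum_seed3 (F : seed A -> seed A -> seed A -> R) :
  \sum_(w : seed3) F w.1.1 w.1.2 w.2 = \sum_a \sum_b \sum_c F a b c.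
Proof. by rewrite pair_bigA pair_bigA. Qed.

Lemma weight3_sum1 : \sum_w weight3 w = 1.
Proof.
rewrite (sum_seed3 (fun a b c => weight A a * weight A b * weight A c)).
rewrite -[RHS](weight_sum1 A); apply: eq_bigr => a _.
under eq_bigr do rewrite -mulr_sumr weight_sum1 mulr1.
by rewrite -mulr_sumr weight_sum1 mulr1.
Qed.

Lemma perm_count_neq0 : #|{perm 'I_n}|%:R != 0 :> R.
Proof. by rewrite pnatr_eq0 -lt0n; apply/card_gt0P; exists 1%g. Qed.

Let canonical_weight (w : {perm 'I_n} * seed3) : R := weight3 w.2 / #|{perm 'I_n}|%:R.

Lemma canonical_weight_ge0 w : 0 <= canonical_weight w.
Proof. by rewrite divr_ge0 ?mulr_ge0 ?weight_ge0. Qed.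

Lemma canonical_weight_sum1 : \sum_w canonical_weight w = 1.
Proof.
rewrite -(pair_bigA _ (fun p w => canonical_weight (p, w))) /=.
under eq_bigr do rewrite -mulr_suml weight3_sum1.
by rewrite sumr_const mul1r -(mulr_natr _^-1) mulVf ?perm_count_neq0.
Qed.

Definition canonical : ralg R n d :=
  RAlg canonical_weight_ge0 canonical_weight_sum1 (fun w => simulate w.1 (tree3 w.2)).

Lemma prob_acceptE (B : ralg R n d) O :
  prob_accept B O = \sum_w weight B w * (run (strategy B w) O)%:R.
Proof.
rewrite /prob_accept big_mkcond; apply: eq_bigr => w _.
by case: run; rewrite ?mulr1 ?mulr0.
Qed.

Lemma prob_rejectE (B : ralg R n d) O : prob_reject B O = 1 - prob_accept B O.
Proof.
apply/eqP; rewrite eq_sym subr_eq addrC -(weight_sum1 B).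
by rewrite [X in X == _](bigID (fun w => run (strategy B w) O)).
Qed.

Lemma prob_accept01 (B : ralg R n d) O : 0 <= prob_accept B O <= 1.
Proof.
apply/andP; split; first by apply: sumr_ge0 => w _; apply: weight_ge0.
rewrite -subr_ge0 -prob_rejectE; apply: sumr_ge0 => w _; exact: weight_ge0.
Qed.

(** The majority indicator is a polynomial affine in each outcome, so [lin] sums out the three seeds
    one at a time. *)
Lemma prob_majority O :
  \sum_w weight3 w * (run (tree3 w) O)%:R =
    prob_accept A O ^+ 2 * (3 - 2 * prob_accept A O).
Proof.
set x := prob_accept A O; pose f a : R := (run (strategy A a) O)%:R.
pose F a b c := weight A a * weight A b * weight A c *
  (f a * f b + f a * f c + f b * f c - 2 * f a * f b * f c).
rewrite (eq_bigr (fun w : seed3 => F w.1.1 w.1.2 w.2)) => [|w _]; last first.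
  rewrite /F /weight3 run_tmajority /f.
  by do 3 case: (run _ O); rewrite /=; lra.
have Ew : \sum_a weight A a = 1 := weight_sum1 A.
have Ef : \sum_a weight A a * f a = x by rewrite /x prob_acceptE.
have lin (u v : R) : \sum_c weight A c * (u + f c * v) = u + x * v.
  under eq_bigr do rewrite mulrDr mulrA.
  by rewrite big_split -!mulr_suml /= Ew Ef mul1r.
rewrite sum_seed3.
under eq_bigr => a _.
  under eq_bigr => b _.
    under eq_bigr => c _.
      rewrite (_ : F a b c = weight A a * weight A b * (weight A c *
        (f a * f b + f c * (f a + f b - 2 * f a * f b)))); last by rewrite /F; ring.
      over.
    rewrite -mulr_sumr lin.
    rewrite (_ : _ * _ = weight A a * (weight A b *
      (x * f a + f b * (f a + x - 2 * x * f a)))); last by ring.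
    over.
  rewrite -mulr_sumr lin.
  rewrite (_ : _ * _ = weight A a * (x * x + f a * (2 * x - 2 * x * x))); last by ring.
  over.
by rewrite lin; ring.
Qed.

Variable q : nat.
Hypothesis A_queries : makes_at_most A q.

Lemma canonical_queries : makes_at_most canonical (d * (3 * q)).
Proof.
move=> G O bG repO w /=; rewrite (num_queries_simulate _ _ bG repO).
rewrite leq_mul2l num_queries_tmajority; apply/orP; right.
have H a : (num_queries (strategy A a) (sorted_oracle (pull w.1 G)) <= q)%N.
  exact: A_queries _ _ (pull_bounded _ bG) (sorted_oracleP _ _) _.
by rewrite -[3%N]/(1 + 1 + 1)%N !mulnDl mul1n !leq_add.
Qed.

Lemma run_tree3 G p w : bounded d G ->
  (run (tree3 w) (sorted_oracle (pull p G)))%:R = accepted R (3 * q) (tree3 w) G p.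
Proof.
move=> bG; rewrite /accepted runf_run // num_queries_tmajority.
have H a : (num_queries (strategy A a) (sorted_oracle (pull p G)) <= q)%N.
  exact: A_queries _ _ (pull_bounded _ bG) (sorted_oracleP _ _) _.
by rewrite -[3%N]/(1 + 1 + 1)%N !mulnDl mul1n !leq_add.
Qed.

(** Summing over names inside and seeds outside suits the coupling, which fixes the coins;
    [mean_acceptE] exchanges the sums for the majority bound. *)
Definition mean_accept G : R :=
  \sum_w weight3 w * (\sum_p accepted R (3 * q) (tree3 w) G p) / #|{perm 'I_n}|%:R.

Lemma prob_accept_canonical G O : bounded d G -> represents O G ->
  prob_accept canonical O = mean_accept G.
Proof.
move=> bG repO; rewrite prob_acceptE /=.
rewrite -(pair_bigA _ (fun p w => canonical_weight (p, w) *
  (run (simulate p (tree3 w)) O)%:R)) /= exchange_big.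
apply: eq_bigr => w _; rewrite mulr_sumr mulr_suml; apply: eq_bigr => p _.
by rewrite (run_simulate _ _ bG repO) run_tree3 // mulrAC.
Qed.

Lemma mean_acceptE G : bounded d G ->
  mean_accept G = (\sum_p let x := prob_accept A (sorted_oracle (pull p G)) in
    x ^+ 2 * (3 - 2 * x)) / #|{perm 'I_n}|%:R.
Proof.
move=> bG; rewrite /mean_accept -mulr_suml; congr (_ / _).
under eq_bigr do rewrite mulr_sumr.
rewrite exchange_big; apply: eq_bigr => p _ /=; rewrite -prob_majority.
by apply: eq_bigr => w _; rewrite run_tree3.
Qed.

Lemma mean_accept_close G H :
    (coupling_threshold d q <= n)%N -> bounded d G -> bounded d H ->
    freq_dist R d (12 * q) G H <= 1 / (12 * (12 * q)%:R) ->
  `|mean_accept G - mean_accept H| <= 1 / 16.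
Proof.
move=> n1n bG bH GH.
rewrite /mean_accept -sumrB [leRHS](_ : _ = \sum_w weight3 w * (1 / 16)); last first.
  by rewrite -mulr_suml weight3_sum1 [RHS]mul1r.
apply: le_trans (ler_norm_sum _ _ _) _; apply: ler_sum => w _.
rewrite -mulrBl -mulrBr -sumrB -mulrA normrM.
have w_ge0 : 0 <= weight3 w by rewrite !mulr_ge0 ?weight_ge0.
rewrite (ger0_norm w_ge0) ler_wpM2l // normrM normfV normr_nat.
rewrite ler_pdivrMr; last by rewrite lt_def perm_count_neq0 ler0n.
exact: close_acceptance.
Qed.

Lemma mean_accept_ge G : bounded d G ->
    (forall p, accepts A (pull p G)) -> 20 / 27 <= mean_accept G.
Proof.
move=> bG accG; rewrite mean_acceptE // ler_pdivlMr; last first.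
  by rewrite lt_def perm_count_neq0 ler0n.
rewrite mulr_natr -sumr_const; apply: ler_sum => p _ /=.
have /andP[_ x1] := prob_accept01 A (sorted_oracle (pull p G)).
by rewrite majority_ge // x1 (accG p _ (sorted_oracleP _ _)).
Qed.

Lemma mean_accept_le G : bounded d G ->
    (forall p, rejects A (pull p G)) -> mean_accept G <= 7 / 27.
Proof.
move=> bG rejG; rewrite mean_acceptE // ler_pdivrMr; last first.
  by rewrite lt_def perm_count_neq0 ler0n.
rewrite mulr_natr -sumr_const; apply: ler_sum => p _ /=.
have := rejG p _ (sorted_oracleP _ _); rewrite prob_rejectE => rejx.
have /andP[x0 _] := prob_accept01 A (sorted_oracle (pull p G)).
by rewrite majority_le // x0 /=; lra.
Qed.

End CanonicalTester.

Theorem theorem3p2 (R : realType) (Pi : nat -> graph_family)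
    (q : R -> nat -> nat)
    (Pi_bounded : forall d : nat, bounded_property d (Pi d))
    (Pi_testable : testable Pi q) :
  exists2 c : nat, (1 < c)%N &
    forall (eps : R) (d : nat), 0 < eps ->
    exists n1 : nat,
    let t := (c * q eps d)%N in
    forall n : nat, (n1 <= n)%N ->
    exists TC : ralg R n d,
      [/\ makes_at_most TC (t * d ^ (t + 2))%N,
          forall G : sgraph n, bounded d G ->
            (min_freq_dist R d t G (Pi d n) <= (1 / (12 * t%:R))%:E)%E ->
            accepts TC G
        & forall G : sgraph n, bounded d G ->
            (min_freq_dist R d t G (far d eps (Pi d) n)
               <= (1 / (12 * t%:R))%:E)%E ->
            rejects TC G].
Proof.
(* Three runs make [3 * q] queries; the factor 12 keeps the loss from bad matches within 1/24. *)
have [A testA] := Pi_testable; exists 12%N => // eps d eps_gt0.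
exists (coupling_threshold d (q eps d)) => t n n1n.
have [A_queries A_acc A_rej] := testA eps n d eps_gt0.
have [isoPi bPi] := Pi_bounded d.
exists (canonical (A eps n d)); split.
- move=> G O bG repO w; apply: leq_trans (canonical_queries A_queries bG repO w) _.
  (* For [d = 0] no query is made; otherwise [3 * q <= t] and [d <= d ^ (t + 2)]. *)
  rewrite /t mulnC; case: (d) => [|d']; first by rewrite muln0.
  apply: leq_mul; first by rewrite leq_mul2r orbT.
  by rewrite addn2 expnS leq_pmulr ?expn_gt0.
- move=> G bG /min_freq_distP[H PH GH] O repO.
  have bH := bPi _ _ PH.
  rewrite (prob_accept_canonical A_queries bG repO).
  have := mean_accept_close (A eps n d) n1n bG bH GH.
  have := mean_accept_ge A_queries bH (fun p => A_acc _ (family_pull p isoPi PH)).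
  (* Numerically [20 / 27 - 1 / 16 >= 2 / 3]; the rejecting case uses [7 / 27 + 1 / 16 <= 1 / 3]. *)
  by rewrite ler_norml => ? /andP[? ?]; lra.
- move=> G bG /min_freq_distP[H PH GH] O repO; have [bH _] := PH.
  rewrite prob_rejectE (prob_accept_canonical A_queries bG repO).
  have := mean_accept_close (A eps n d) n1n bG bH GH.
  have := mean_accept_le A_queries bH (fun p => A_rej _ (far_pull p isoPi PH)).
  by rewrite ler_norml => ? /andP[? ?]; lra.
Qed.
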